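(* Let $p(x,y)$ be a real polynomial with $p(0,0)=0$, $\nabla p(0,0)=(0,0)$, $\dim\operatorname{Co}N_p=2$, such that for every $A\in\mathbb{N}^2$ the main $A$-quasi-homogeneous form of $p$ is nonnegative on $\mathbb{R}^2$. Suppose $\mathcal{A}_p\neq\emptyset$ and that for every $A\in\mathcal{A}_p$ at least one of the conditions $(C2)_A$, $(\tilde C2)_A$ holds. Then $(0,0)$ is a point of local minimum of $p$.
   Context: $\mathbb{N}=\{1,2,\dots\}$; $\mathbb{N}_0^2$ is the set of $(A_1,A_2)\in\mathbb{N}^2$ with $\gcd(A_1,A_2)=1$. $N_p$ is the support of $p$ and $\operatorname{Co}N_p$ its convex hull. For $A\in\mathbb{N}^2$ the main $A$-quasi-homogeneous form of $p$ is the sum of the terms of $p$ whose exponent vectors $k$ minimize $\langle A,k\rangle$ over $N_p$. For $A\in\mathbb{N}_0^2$, with $B_1^A<\dots<B_{r_A}^A$ the distinct values of $\langle A,k\rangle$ on $N_p$, $\varphi_i^A$ is the sum of terms of $p$ with $\langle A,k\rangle=B_i^A$ ($\varphi_i^A:=0$ for $i>r_A$). The characteristic polynomial of $\varphi_1^A=\sum_ia_ix^{\alpha_i}y^{\beta_i}$ ($a_i\ne0$, $\alpha_1>\alpha_2>\dots$) is $g_1^A(u)=\sum_ia_iu^{(\alpha_1-\alpha_i)/A_2}$. $\mathcal{A}_p$ is the set of $A\in\mathbb{N}_0^2$ such that $\varphi_1^A$ has at least three terms, $g_1^A\ge0$ on $\mathbb{R}$, and $g_1^A$ has a real root. $H_\varphi=\{(x,y):\varphi(x,y)=0\}$.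 Condition $(C2)_A$: for all $(x,y)\in H_{\varphi_1^A}$ with $x\ne0,y\ne0$, $\varphi_2^A(x,y)>0$. Condition $(\tilde C2)_A$: for all $(x,y)\in H_{\varphi_1^A}\cap H_{\varphi_2^A}$ with $x\neq0$, $y\neq0$, $\varphi_3^A(x,y)>0$, and $\varphi_2^A(x,y)\ge0$ for all $(x,y)\in\mathbb{R}^2$. Local minimum at $(0,0)$ means $p\ge p(0,0)$ near $(0,0)$. *)

(* Defs.v *)
(* Real bivariate polynomials are represented as
   p : {poly {poly R}} with R : realType; the coefficient of x^i y^j is
   (p`_i)`_j  (outer variable = x, inner variable = y). *)
From HB Require Import structures.
From mathcomp Require Import all_boot all_order all_algebra.
From mathcomp Require Import reals.
Set Implicit Arguments. Unset Strict Implicit. Unset Printing Implicit Defensive.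
Import Order.TTheory GRing.Theory Num.Theory.
Local Open Scope ring_scope.

Section Bivariate.
Variable R : realType.
Implicit Types (p q : {poly {poly R}}).

Definition peval p (x y : R) : R := (map_poly (fun q : {poly R} => q.[y]) p).[x].

Definition dx p : {poly {poly R}} := p^`().
Definition dy p : {poly {poly R}} := map_poly (fun q : {poly R} => q^`()) p.

Definition supp p : seq (nat * nat) :=
  [seq k <- [seq (i, j) | i <- iota 0 (size p), j <- iota 0 (size p`_i)]
     | (p`_k.1)`_k.2 != 0].

(* dim Co N_p = 2 : N_p contains three affinely independent points *)
Definition conv_dim2 p : Prop :=
  exists k0 k1 k2, [/\ k0 \in supp p, k1 \in supp p, k2 \in supp p &
    ((k1.1%:Z - k0.1%:Z) * (k2.2%:Z - k0.2%:Z)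
       - (k1.2%:Z - k0.2%:Z) * (k2.1%:Z - k0.1%:Z) != 0)%R].

Definition weight (A : nat * nat) (k : nat * nat) : nat := (A.1 * k.1 + A.2 * k.2)%N.

Definition weights p (A : nat * nat) : seq nat :=
  sort leq (undup [seq weight A k | k <- supp p]).

Definition qh_part p (A : nat * nat) (B : nat) : {poly {poly R}} :=
  \poly_(i < size p) \poly_(j < size (p`_i))
     (if weight A (i, j) == B then (p`_i)`_j else 0).

Definition phi p (A : nat * nat) (i : nat) : {poly {poly R}} :=
  if (0 < i)%N && (i <= size (weights p A))%N
  then qh_part p A (nth 0%N (weights p A) i.-1) else 0.

Definition main_form p (A : nat * nat) : {poly {poly R}} :=
  qh_part p A (head 0%N (weights p A)).

Definition charpoly (ph : {poly {poly R}}) (A2 : nat) : {poly R} :=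
  let a1 := \max_(k <- supp ph) k.1 in
  \sum_(k <- supp ph) (ph`_k.1)`_k.2 *: 'X^((a1 - k.1) %/ A2).

Definition in_Ap p (A : nat * nat) : Prop :=
  [/\ (0 < A.1)%N, (0 < A.2)%N, coprime A.1 A.2,
      (3 <= size (supp (phi p A 1)))%N &
      (forall u : R, 0 <= (charpoly (phi p A 1) A.2).[u]) /\
      exists u : R, root (charpoly (phi p A 1) A.2) u].

Definition C2 p (A : nat * nat) : Prop :=
  forall x y : R, x != 0 -> y != 0 -> peval (phi p A 1) x y = 0 ->
    0 < peval (phi p A 2) x y.

Definition C2tilde p (A : nat * nat) : Prop :=
  (forall x y : R, x != 0 -> y != 0 -> peval (phi p A 1) x y = 0 ->
      peval (phi p A 2) x y = 0 -> 0 < peval (phi p A 3) x y)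
  /\ (forall x y : R, 0 <= peval (phi p A 2) x y).

Definition local_min_at0 p : Prop :=
  exists2 d : R, 0 < d & forall x y : R, `|x| < d -> `|y| < d ->
    peval p 0 0 <= peval p x y.

End Bivariate.

(* Main.v *)
(* Write |x| = e^-X and |y| = e^-Y with X, Y large, and let k0 be an exponent
   of p for which the monomial |x|^i |y|^j is largest.  If it beats every other
   monomial by a large factor K, then k0 is the unique minimiser over N_p of the
   integer weight (floor X, floor Y), so nonnegativity of that main form makes
   the k0-term of p positive and it dominates the sum.  Otherwise some k1 is
   comparable to k0; then (X, Y) stays at bounded distance from the ray spanned
   by the primitive A orthogonal to k1 - k0, that is |x| = t^A1 and
   |y| = t^A2 z with t small and z in the compact interval [1/K, K].  On this
   interval p = t^B1 (phi1 + t^(B2-B1) phi2 + t^(B3-B1) phi3 + ...) is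
   nonnegative for small t: this is clear where phi1 > 0, and a zero of phi1
   off the axes forces A to be in A_p, so that (C2) or (C2~) applies. *)
Require Import Defs.
From HB Require Import structures.
From mathcomp Require Import all_boot all_order all_algebra.
From mathcomp Require Import boolp reals classical_sets topology normedtype.
From mathcomp Require Import sequences derive realfun exp.
From mathcomp Require Import zify ring lra.
Import Order.TTheory GRing.Theory Num.Theory numFieldNormedType.Exports.
Local Open Scope ring_scope.

Section LocalMinimum.
Variable R : realType.
Implicit Types (p q : {poly {poly R}}) (A k : nat * nat).

(** * Supports, weights and quasi-homogeneous parts *)

Definition term p k (x y : R) : R := (p`_k.1)`_k.2 * x ^+ k.1 * y ^+ k.2.

Lemma mem_supp p k : (k \in supp p) = ((p`_k.1)`_k.2 != 0).
Proof.
rewrite /supp mem_filter; case: (boolP (_ != 0)) => //= pk0.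
apply/allpairsPdep; exists k.1, k.2; rewrite -surjective_pairing.
have h (S : nzRingType) (s : {poly S}) i : s`_i != 0 -> i \in iota 0 (size s).
  by move=> si; rewrite mem_iota add0n ltnNge; apply: contra si => /(nth_default 0) ->.
split=> //; last exact: h.
by apply: h; apply: contra pk0 => /eqP ->; rewrite coef0.
Qed.

Lemma supp_uniq p : uniq (supp p).
Proof.
apply/filter_uniq/allpairs_uniq_dep; rewrite ?iota_uniq //.
- by move=> *; apply: iota_uniq.
- by move=> [a b] [c d] _ _ /= [-> ->].
Qed.

Lemma peval_sum p x y : peval p x y = \sum_(k <- supp p) term p k x y.
Proof.
rewrite /supp big_filter big_mkcond /= big_allpairs_dep /peval /=.
rewrite /map_poly horner_poly.
have io n : iota 0 n = index_iota 0 n by rewrite /index_iota subn0.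
rewrite io big_mkord; apply: eq_bigr => i _.
rewrite horner_coef mulr_suml io big_mkord; apply: eq_bigr => j _.
by rewrite /term /=; case: eqP => [->|_]; rewrite ?mul0r // mulrAC.
Qed.

Lemma coef_qh p A B i j :
  (qh_part p A B)`_i`_j = if weight A (i, j) == B then p`_i`_j else 0.
Proof.
rewrite /qh_part coef_poly; case: ltnP => [_|lpi]; last first.
  by rewrite [p`_i]nth_default // coef0 if_same.
rewrite coef_poly; case: ltnP => // lpj.
by rewrite [(p`_i)`_j]nth_default // if_same.
Qed.

Lemma mem_supp_qh p A B k :
  (k \in supp (qh_part p A B)) = (k \in supp p) && (weight A k == B).
Proof.
rewrite !mem_supp coef_qh -surjective_pairing andbC.
by case: (_ == B) => //; rewrite eqxx.
Qed.

Lemma peval_qh p A B x y :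
  peval (qh_part p A B) x y = \sum_(k <- supp p | weight A k == B) term p k x y.
Proof.
rewrite peval_sum -[RHS]big_filter; rewrite (perm_big [seq k <- supp p | weight A k == B]).
  apply: eq_big_seq => k; rewrite mem_filter => /andP[wk _].
  by rewrite /term coef_qh -surjective_pairing wk.
apply: uniq_perm => [||k]; [exact: supp_uniq | exact/filter_uniq/supp_uniq |].
by rewrite [RHS]mem_filter mem_supp_qh andbC.
Qed.

Lemma mem_weights p A w :
  (w \in weights p A) = (w \in [seq weight A k | k <- supp p]).
Proof. by rewrite mem_sort mem_undup. Qed.

Lemma weights_sorted p A : sorted ltn (weights p A).
Proof.
rewrite ltn_sorted_uniq_leq sort_uniq undup_uniq /=.
by apply: sort_sorted; apply: leq_total.
Qed.

(** The substitution multiplies the [k]-term by [t ^+ weight A k]; grouping equal weights gives an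
    expansion in powers of [t] whose lowest coefficient is the main form. *)
Lemma peval_weighted p A t x y :
  peval p (t ^+ A.1 * x) (t ^+ A.2 * y) =
  \sum_(w <- weights p A) t ^+ w * peval (qh_part p A w) x y.
Proof.
under eq_bigr do rewrite peval_qh mulr_sumr big_mkcond.
rewrite exchange_big /= peval_sum; apply: eq_big_seq => k ks.
have wk : weight A k \in weights p A by rewrite mem_weights map_f.
rewrite -big_mkcond /= -big_filter; under eq_filter do rewrite eq_sym.
rewrite filter_pred1_uniq ?sort_uniq ?undup_uniq // big_seq1.
by rewrite /term !exprMn -!exprM /weight exprD; ring.
Qed.

Lemma head_weights p A k B :
  k \in supp p -> weight A k = B ->
  (forall k', k' \in supp p -> (B <= weight A k')%N) -> head 0%N (weights p A) = B.
Proof.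
move=> ks wk minB; have := weights_sorted p A.
have: B \in weights p A by rewrite mem_weights -wk map_f.
have hw w : w \in weights p A -> (B <= w)%N.
  by rewrite mem_weights => /mapP[k' k's ->]; exact: minB.
case: (weights p A) hw => //= w s hw; rewrite inE => /predU1P[->//|Bs].
move=> /(order_path_min ltn_trans)/allP/(_ _ Bs) wB.
by have := hw w (mem_head _ _); rewrite leqNgt wB.
Qed.

Lemma min_weightP p A k : k \in supp p ->
  exists k0, [/\ k0 \in supp p, weight A k0 = head 0%N (weights p A) &
   forall k', k' \in supp p -> (weight A k0 <= weight A k')%N].
Proof.
move=> ks; set b := head _ _.
have hw w : w \in weights p A -> (b <= w)%N.
  rewrite /b; have := weights_sorted p A.
  case: (weights p A) => //= v s /(order_path_min ltn_trans)/allP h.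
  by rewrite inE => /predU1P[->//|/h/ltnW].
have /mapP[k0 k0s bk0] : b \in [seq weight A k | k <- supp p].
  rewrite -mem_weights /b; have: weight A k \in weights p A by rewrite mem_weights map_f.
  by case: (weights p A) => // *; exact: mem_head.
by exists k0; split=> // k' k's; rewrite -bk0 hw // mem_weights map_f.
Qed.

(** * Vertices of the Newton polygon *)

Definition main_nonneg p := forall A, (0 < A.1)%N -> (0 < A.2)%N ->
  forall x y : R, 0 <= peval (main_form p A) x y.

Definition even_pos p k := [&& 0 < (p`_k.1)`_k.2, ~~ odd k.1 & ~~ odd k.2].

Lemma even_pos_term_gt0 p k x y :
  even_pos p k -> x != 0 -> y != 0 -> 0 < term p k x y.
Proof.
move=> /and3P[ck o1 o2] x0 y0.
by rewrite /term !mulr_gt0 // exprn_even_gt0 // (x0, y0) orbT.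
Qed.

(** A strict minimiser reduces the main form to the single [k]-term; its values at (1,1), (-1,1) and
    (1,-1) give the sign of the coefficient and the two parities. *)
Lemma main_form_vertex p A k : main_nonneg p -> (0 < A.1)%N -> (0 < A.2)%N ->
  k \in supp p ->
  (forall k', k' \in supp p -> k' != k -> (weight A k < weight A k')%N) ->
  even_pos p k.
Proof.
move=> H A1 A2 ks kmin.
have Hk x y : 0 <= term p k x y.
  have := H _ A1 A2 x y; rewrite /main_form (head_weights _ _ k (weight A k)) //; last first.
    by move=> k' k's; have [->|k'k] := eqVneq k' k; rewrite ?leqnn // ltnW ?kmin.
  rewrite peval_qh -big_filter.
  rewrite (perm_big [:: k]) ?big_seq1 //; apply: uniq_perm => // [|k'].
    exact/filter_uniq/supp_uniq.
  rewrite mem_filter inE; have [->|k'k] := eqVneq k' k; first by rewrite eqxx.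
  apply/negbTE/nandP; case: (boolP (k' \in _)) => [k's|]; [left | by right].
  by rewrite neq_ltn kmin ?orbT.
have c0 : 0 < (p`_k.1)`_k.2.
  have := Hk 1 1; rewrite /term !expr1n !mulr1 lt0r => ->.
  by rewrite -mem_supp ks.
have oddN n : (p`_k.1)`_k.2 * (-1) ^+ n >= 0 -> ~~ odd n.
  by rewrite -signr_odd; case: odd => //; rewrite expr1 mulrN1 oppr_ge0 leNgt c0.
apply/and3P; split=> //; apply: oddN.
  by have := Hk (-1) 1; rewrite /term expr1n mulr1.
by have := Hk 1 (-1); rewrite /term expr1n mulr1.
Qed.

(* Perturbing A to a multiple plus a unit vector isolates an end of the edge. *)
Lemma main_form_end p A k : main_nonneg p -> (0 < A.1)%N -> (0 < A.2)%N ->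
  k \in supp p ->
  (forall k', k' \in supp p -> (weight A k <= weight A k')%N) ->
  (forall k', k' \in supp p -> weight A k' = weight A k -> (k'.1 <= k.1)%N) \/
  (forall k', k' \in supp p -> weight A k' = weight A k -> (k.1 <= k'.1)%N) ->
  even_pos p k.
Proof.
move: A k => [A1 A2] [a b] H /= A10 A20 ks kmin [kx|kx].
(* With multiplier [b.+1], one unit of [A]-weight outweighs any drop of the second exponent, which
   is at most [b]; the added unit then only breaks ties on the edge. The second case does the same
   with [a.+1] and the first exponent. *)
- apply: (@main_form_vertex _ (b.+1 * A1, b.+1 * A2 + 1)%N _ H) => //=; try lia.
  move=> [a' b'] k's; rewrite xpair_eqE => k'k; have /= := kx _ k's.
  have := kmin _ k's; rewrite leq_eqVlt /weight /= => /predU1P[e|].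
    move=> /(_ (esym e)); rewrite leq_eqVlt => /predU1P[ea|]; last by nia.
    by move: e k'k; rewrite ea eqxx /=; nia.
  by nia.
- apply: (@main_form_vertex _ (a.+1 * A1 + 1, a.+1 * A2)%N _ H) => //=; try lia.
  move=> [a' b'] k's; rewrite xpair_eqE => k'k; have /= := kx _ k's.
  have := kmin _ k's; rewrite leq_eqVlt /weight /= => /predU1P[e|].
    move=> /(_ (esym e)); rewrite leq_eqVlt => /predU1P[ea|]; last by nia.
    by move: e k'k; rewrite ea eqxx /=; nia.
  by nia.
Qed.

(** * Zeros of the main form off the axes *)

Lemma phi1E p A k : k \in supp p -> phi p A 1 = main_form p A.
Proof.
move=> ks; rewrite /phi /main_form nth0 /=.
have: weight A k \in weights p A by rewrite mem_weights map_f.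
by case: (weights p A).
Qed.

Lemma pos_root n (u : R) : (0 < n)%N -> 0 < u -> exists2 v, 0 < v & v ^+ n = u.
Proof.
move=> n0 u0; exists (expR (ln u / n%:R)); first exact: expR_gt0.
by rewrite -expRM_natl mulrC divfK ?pnatr_eq0 -?lt0n // lnK.
Qed.

Lemma odd_root n (u : R) : odd n -> u != 0 -> exists2 v, v != 0 & v ^+ n = u.
Proof.
move=> on u0; have [|v v0 vn] := @pos_root n `|u| (odd_gt0 on); first by rewrite normr_gt0.
exists (Num.sg u * v); first by rewrite mulf_neq0 ?sgr_eq0 // gt_eqF.
rewrite exprMn vn; have [up|un|/eqP] := ltrgtP 0 u.
- by rewrite gtr0_sg // expr1n mul1r gtr0_norm.
- by rewrite ltr0_sg // -signr_odd on expr1 ltr0_norm // mulrNN mul1r.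
- by rewrite eq_sym (negPf u0).
Qed.

(** Continuity at 0. This recovers the value u = 0 of the characteristic polynomial and, later, the
    points on the axes. *)
Lemma horner_ge0_at0 (P : {poly R}) d : 0 < d ->
  (forall y, y != 0 -> `|y| < d -> 0 <= P.[y]) -> 0 <= P.[0].
Proof.
move=> d0 HP; apply: (@cvgr_to_ge _ (0^'+)%classic _ _ (fun y => P.[y])).
  by apply: cvg_at_right_filter; exact: continuous_horner.
near=> y; have y0 : 0 < y by near: y; exact: nbhs_right_gt.
apply: HP; first by rewrite gt_eqF.
by rewrite gtr0_norm //; near: y; exact: nbhs_right_lt.
Unshelve. all: by end_near. Qed.

Lemma seq_argmax (T : eqType) d (U : orderType d) (f : T -> U) (s : seq T) x :
  x \in s -> exists2 m, m \in s & forall y, y \in s -> (f y <= f m)%O.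
Proof.
elim: s x => // a [|b s] IH x _.
  by exists a; rewrite ?mem_head // => y; rewrite inE => /eqP ->.
have [m ms mmax] := IH b (mem_head _ _).
have [am|ma] := leP (f a) (f m).
  exists m; first by rewrite inE ms orbT.
  by move=> y; rewrite inE => /predU1P[->//|]; exact: mmax.
exists a; first exact: mem_head.
move=> y; rewrite inE => /predU1P[->//|/mmax ym].
exact: le_trans ym (ltW ma).
Qed.

(* u = y^A1 / x^A2, with the denominator cleared. *)
Lemma charpoly_peval p A B km x y u : (0 < A.1)%N -> (0 < A.2)%N -> coprime A.1 A.2 ->
  km \in supp (qh_part p A B) ->
  (forall k, k \in supp (qh_part p A B) -> (k.1 <= km.1)%N) ->
  y ^+ A.1 = u * x ^+ A.2 ->
  peval (qh_part p A B) x y =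
  x ^+ km.1 * y ^+ km.2 * (charpoly (qh_part p A B) A.2).[u].
Proof.
move: A km => [A1 A2] [a b]; set q := qh_part _ _ _ => /= A10 A20 co ms mmax xy.
rewrite peval_sum /charpoly horner_sum mulr_sumr.
have -> : \max_(k <- supp q) k.1 = a.
  apply/eqP; rewrite eqn_leq; apply/andP; split; last exact: (leq_bigmax_seq (a, b)).
  by apply/bigmax_leqP_seq => k ks _; exact: mmax.
apply: eq_big_seq => -[i j] ks; rewrite hornerZ hornerXn /term /=.
have := mmax _ ks; move: (ks) ms; rewrite !mem_supp_qh /weight /=.
move=> /andP[_ /eqP wk] /andP[_ /eqP wm] /= ia.
(* Equal weights give A1 (a - i) = A2 (j - b), so coprimality makes the truncated division in
   [charpoly] exact. *)
have /dvdnP[t et] : (A2 %| a - i)%N.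
  by rewrite -(Gauss_dvdr _ (_ : coprime A2 A1)) 1?coprime_sym //; apply/dvdnP; exists (j - b)%N; nia.
rewrite et mulnK //; have -> : a = (i + A2 * t)%N by lia.
have -> : j = (b + A1 * t)%N by nia.
by rewrite !exprD !exprM xy exprMn; ring.
Qed.

(** If the main form had one or two terms, each would be an end of the edge, hence positive off the
    axes, and no zero could occur there. The zero itself yields the root y^A1 / x^A2, and
    nonnegativity of the form passes to the characteristic polynomial. *)
Lemma zero_in_Ap p A k x y : main_nonneg p ->
  (0 < A.1)%N -> (0 < A.2)%N -> coprime A.1 A.2 ->
  k \in supp p -> x != 0 -> y != 0 -> peval (phi p A 1) x y = 0 -> in_Ap p A.
Proof.
move=> H A1 A2 co ks x0 y0; have phiE := phi1E p A k ks.
have [k0 [k0s wk0 k0min]] := min_weightP p A k ks.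
have := H A A1 A2; rewrite /in_Ap phiE {phiE} /main_form; set b := head _ _ in wk0 *.
set q := qh_part p A b => qge0 q0.
have sq k' : k' \in supp q -> k' \in supp p /\ weight A k' = b.
  by rewrite mem_supp_qh => /andP[-> /eqP].
have Hend k' : k' \in supp q ->
    (forall l, l \in supp q -> (l.1 <= k'.1)%N) \/
    (forall l, l \in supp q -> (k'.1 <= l.1)%N) -> even_pos q k'.
  move=> k'q ext; have [k's wk'] := sq _ k'q.
  have qE : (q`_k'.1)`_k'.2 = (p`_k'.1)`_k'.2.
    by rewrite coef_qh -surjective_pairing wk' eqxx.
  have -> : even_pos q k' = even_pos p k' by rewrite /even_pos qE.
  apply: (main_form_end p A k' H) => // [l|]; first by rewrite wk' -wk0; exact: k0min.
  by case: ext => ext; [left|right] => l ls wl; apply: ext;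
    rewrite mem_supp_qh ls wl wk' /=.
have k0q : k0 \in supp q by rewrite mem_supp_qh k0s wk0 /=.
split=> //.
  move: q0; rewrite peval_sum.
  case: (supp q) k0q Hend => [//|k1 [_ Hend|k2 [_ Hend|//]]] /=.
    rewrite big_seq1 => t0; suff ek : even_pos q k1.
      by have := even_pos_term_gt0 _ _ _ _ ek x0 y0; rewrite t0 ltxx.
    apply: Hend; rewrite ?mem_head //.
    by left=> l; rewrite inE => /eqP ->.
  rewrite big_cons big_seq1 => t0.
  suff: 0 < term q k1 x y + term q k2 x y by rewrite t0 ltxx.
  have tot := leq_total k1.1 k2.1.
  by apply: addr_gt0; apply: even_pos_term_gt0 => //; apply: Hend;
    rewrite ?inE ?eqxx ?orbT //; case/orP: tot => tot; 
    ((by left=> l; rewrite !inE => /orP[] /eqP ->) || (by right=> l; rewrite !inE => /orP[] /eqP ->)).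
have [km kmq kmax] := @seq_argmax _ _ _ (fun k : nat * nat => k.1) _ _ k0q.
have cpE x' y' u := @charpoly_peval p A b km x' y' u A1 A2 co kmq kmax.
split; last first.
  exists (y ^+ A.1 / x ^+ A.2); apply/rootP/eqP.
  have := cpE x y (y ^+ A.1 / x ^+ A.2); rewrite divfK ?expf_neq0 // q0.
  by move=> /(_ erefl)/esym/eqP; rewrite mulf_eq0 (negPf (mulf_neq0 _ _)) ?expf_neq0.
(* [km] is an end of the edge, so the monomial in front of the characteristic polynomial is positive
   off the axes. *)
have /and3P[_ e1 e2] : even_pos q km by apply: Hend => //; left.
have cp_ge0 x' y' u : x' != 0 -> y' != 0 -> y' ^+ A.1 = u * x' ^+ A.2 ->
    0 <= (charpoly q A.2).[u].
  move=> x'0 y'0 /cpE; have := qge0 x' y'; rewrite -/q => /[swap] ->.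
  by rewrite pmulr_rge0 // mulr_gt0 // exprn_even_gt0 // (x'0, y'0) orbT.
suff cpN0 u : u != 0 -> 0 <= (charpoly q A.2).[u].
  move=> u; have [->|] := eqVneq u 0; last exact: cpN0.
  by apply: (horner_ge0_at0 _ 1) => // v v0 _; exact: cpN0.
(* By coprimality [A.1] or [A.2] is odd, so y^A1 = u x^A2 is solvable for either sign of u: with x =
   1 in the first case, with y = 1 in the second. *)
move=> u0; case: (boolP (odd A.1)) => o1.
  have [v v0 vE] := odd_root _ _ o1 u0.
  by apply: (@cp_ge0 1 v) => //; rewrite ?oner_eq0 // expr1n mulr1.
have o2 : odd A.2.
  apply: contraLR co => o2; rewrite /coprime; apply/negP => /eqP co.
  have : (2 %| gcdn A.1 A.2)%N by rewrite dvdn_gcd !dvdn2 o1 o2.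
  by rewrite co.
have [v v0 vE] := odd_root _ _ o2 (invr_neq0 u0).
by apply: (@cp_ge0 v 1) => //; rewrite ?oner_eq0 // expr1n vE divff.
Qed.

(** * Nonnegativity along an edge *)

Lemma peval_yslice q x y :
  peval q x y = (\sum_(k <- supp q) ((q`_k.1)`_k.2 * x ^+ k.1) *: 'X^(k.2)).[y].
Proof.
by rewrite peval_sum horner_sum; apply: eq_bigr => k _; rewrite hornerZ hornerXn.
Qed.

Lemma continuous_peval_scaled q (x d : R) :
  continuous (fun y : R => peval q x (d * y)).
Proof.
have -> : (fun y => peval q x (d * y)) = horner
    (\sum_(k <- supp q) ((q`_k.1)`_k.2 * x ^+ k.1) *: 'X^(k.2)) \o *%R d.
  by apply/funext => y; exact: peval_yslice.
by move=> y; apply: continuous_comp; [exact: mulrl_continuous | exact: continuous_horner].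
Qed.

Lemma near_right_gt0 (y0 : R) :
  (\forall y \near y0 & t \near (0 : R)^'+, 0 < t)%classic.
Proof. exact: (@cvg_snd _ _ (nbhs y0) ((0 : R)^'+)%classic _ _ (nbhs_right_gt 0)). Qed.

(** After division by [t ^+ b] the tail tends to 0 jointly in y and t, leaving the positive limit
    [f b y0]. The joint neighbourhood is what the compactness argument needs. *)
Lemma near_lead_ge0 (s : seq nat) b (f : nat -> R -> R) (y0 : R) :
  path ltn b s -> (forall w, continuous (f w)) -> 0 < f b y0 ->
  (\forall y \near y0 & t \near (0 : R)^'+,
     0 <= \sum_(w <- b :: s) t ^+ w * f w y)%classic.
Proof.
move=> /(order_path_min ltn_trans) bs fc fb0.
pose F : set_system (R * R) := filter_prod (nbhs y0) ((0 : R)^'+)%classic.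
have FF : Filter F by exact: filter_prod_filter.
have tail : ((\sum_(w <- s) z.2 ^+ (w - b) * f w z.1)
    @[z --> F] --> (0 : R))%classic.
  elim: s bs => [_|w s IH /= /andP[bw /IH {}IH]].
    by under eq_fun do rewrite big_nil; exact: cvg_cst.
  under eq_fun do rewrite big_cons.
  have t0 : ((z.2 ^+ (w - b)) @[z --> F] --> (0 : R))%classic.
    apply: (@cvg_comp _ _ _ snd (fun t : R => t ^+ (w - b))); first exact: cvg_snd.
    apply: cvg_at_right_filter.
    have := @exprn_continuous R (w - b) 0.
    by rewrite /continuous_at expr0n gtn_eqF ?subn_gt0.
  have fw : (f w z.1 @[z --> F] --> f w y0)%classic.
    by apply: (@cvg_comp _ _ _ fst (f w)); [exact: cvg_fst | exact: fc].
  by have /(_ FF FF) := cvgD (cvgM t0 fw) IH; rewrite mul0r addr0.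
have lead : ((f b z.1 + \sum_(w <- s) z.2 ^+ (w - b) * f w z.1)
    @[z --> F] --> f b y0)%classic.
  have fb : (f b z.1 @[z --> F] --> f b y0)%classic.
    by apply: (@cvg_comp _ _ _ fst (f b)); [exact: cvg_fst | exact: fc].
  by have /(_ FF) := cvgD fb tail; rewrite addr0.
have tpos := near_right_gt0 y0.
have := @cvgr_gt _ _ _ FF _ _ lead 0 fb0; apply: filterS2 tpos => -[y t] /= t0 lt0.
rewrite big_cons; have -> : \sum_(w <- s) t ^+ w * f w y =
    t ^+ b * \sum_(w <- s) t ^+ (w - b) * f w y.
  rewrite mulr_sumr; apply: eq_big_seq => w /(allP bs) bw.
  by rewrite mulrA -exprD subnKC // ltnW.
by rewrite -mulrDr mulr_ge0 ?exprn_ge0 ?ltW.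
Qed.

(** Compactness of [1/K, K] makes the bound on t uniform in y. Near a fixed [y0], the first
    nonvanishing value among the three lowest coefficients is positive and decides the sign. *)
Lemma edge_ge0 p A k (e d K : R) : main_nonneg p ->
  (forall A, in_Ap p A -> C2 p A \/ C2tilde p A) ->
  (0 < A.1)%N -> (0 < A.2)%N -> coprime A.1 A.2 ->
  k \in supp p -> e != 0 -> d != 0 -> 0 < K ->
  (\forall t \near (0 : R)^'+, forall y, K^-1 <= y <= K ->
    0 <= peval p (t ^+ A.1 * e) (t ^+ A.2 * (d * y)))%classic.
Proof.
move=> H HC A1 A2 co ks e0 d0 K0.
have /compact_near_coveringP cpt := @segment_compact R K^-1 K.
suff loc : (forall y0, K^-1 <= y0 <= K ->
    \forall y \near y0 & t \near (0 : R)^'+,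
      0 <= peval p (t ^+ A.1 * e) (t ^+ A.2 * (d * y)))%classic.
  have FF : Filter ((0 : R)^'+)%classic by exact: at_right_proper_filter.
  apply: filterS (cpt R ((0 : R)^'+)%classic
    (fun t y => 0 <= peval p (t ^+ A.1 * e) (t ^+ A.2 * (d * y))) FF _).
    by move=> t ht y yK; apply: ht; rewrite /= in_itv.
  by move=> y0 /=; rewrite in_itv; exact: loc.
move=> y0 /andP[Ky0 _].
have y00 : d * y0 != 0.
  by rewrite mulf_neq0 // gt_eqF // (lt_le_trans _ Ky0) ?invr_gt0.
pose f w y := peval (qh_part p A w) e (d * y).
suff : (\forall y \near y0 & t \near (0 : R)^'+,
     0 <= \sum_(w <- weights p A) t ^+ w * f w y)%classic.
  by apply: filterS => -[y t] /=; rewrite peval_weighted.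
have fc w : continuous (f w) by exact: continuous_peval_scaled.
have tpos := near_right_gt0 y0.
have := zero_in_Ap p A k e (d * y0) H A1 A2 co ks e0 y00.
have := H A A1 A2 e; have := weights_sorted p A.
have := HC A; rewrite /C2 /C2tilde /main_form /phi.
have : weight A k \in weights p A by rewrite mem_weights map_f.
case: (weights p A) => //= b1 s _ {}HC ss f1ge0 inA.
have [f1p|f1n|f10] := ltrgtP 0 (f b1 y0).
- exact: near_lead_ge0.
- by have := f1ge0 (d * y0); rewrite leNgt f1n.
move: HC => /(_ (inA (esym f10))).
(* With a single weight, [phi p A 2] and [phi p A 3] default to 0, and either condition fails at the
   zero. *)
case: s ss inA => [|b2 s] ss inA /=.
  case=> [/(_ e (d * y0) e0 y00 (esym f10))|[/(_ e (d * y0) e0 y00 (esym f10))]];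
    by rewrite /peval map_poly0 horner0 ltxx // => /(_ erefl).
(* The [b1]-summand is nonnegative everywhere, so it can be split off and [b2] becomes the leading
   weight. *)
have f2_ok : 0 < f b2 y0 ->
    (\forall y \near y0 & t \near (0 : R)^'+,
     0 <= \sum_(w <- [:: b1, b2 & s]) t ^+ w * f w y)%classic.
  move=> f2p; have /andP[_ ss2] := ss.
  have := near_lead_ge0 _ _ _ _ ss2 fc f2p.
  apply: filterS2 tpos => -[y t] /= t0 le0.
  rewrite big_cons addr_ge0 // mulr_ge0 ?exprn_ge0 ?(ltW t0) //; exact: f1ge0.
case=> [/(_ e (d * y0) e0 y00 (esym f10))/f2_ok//|[C3 f2ge0]].
have [f2p|f2n|f20] := ltrgtP 0 (f b2 y0).
- exact: f2_ok.
- by have := f2ge0 e (d * y0); rewrite leNgt f2n.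
move: C3 => /(_ e (d * y0) e0 y00 (esym f10) (esym f20)).
case: s ss inA f2_ok f2ge0 => [|b3 s] /= ss inA _ f2ge0.
  by rewrite /peval map_poly0 horner0 ltxx.
move=> f3p; have /and3P[_ _ ss3] := ss.
have := near_lead_ge0 _ _ _ _ ss3 fc f3p.
apply: filterS2 tpos => -[y t] /= t0 le0.
rewrite big_cons big_cons.
by apply: addr_ge0; [|apply: addr_ge0 => //]; apply: mulr_ge0;
  rewrite ?exprn_ge0 ?(ltW t0) //; [exact: f1ge0 | exact: f2ge0].
Qed.

(** * Comparable and dominant monomials *)

Definition mono (x y : R) k := x ^+ k.1 * y ^+ k.2.

Lemma mono_gt0 x y k : 0 < x -> 0 < y -> 0 < mono x y k.
Proof. by move=> x0 y0; rewrite mulr_gt0 // exprn_gt0. Qed.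

(** Otherwise [mono x y l] is [mono x y k] times a nonconstant monomial; one factor x or y of it is
    below 1/K and the others are at most 1. *)
Lemma mono_ratio x y K k l : 1 <= K -> 0 < x -> 0 < y -> x * K < 1 -> y * K < 1 ->
  k != l -> (k.1 <= l.1)%N -> mono x y k <= K * mono x y l -> (l.2 < k.2)%N.
Proof.
move: k l => [a b] [c d]; rewrite xpair_eqE /mono /= => K1 x0 y0 xK yK kl ac; apply: contraTT.
rewrite -leqNgt -ltNge => bd; have K0 : 0 < K by exact: lt_le_trans K1.
have x1 : x < 1 by nra.
have y1 : y < 1 by nra.
rewrite -(subnKC ac) -(subnKC bd) !exprD.
set i := (c - a)%N; set j := (d - b)%N.
have ab0 : 0 < x ^+ a * y ^+ b by rewrite mulr_gt0 // exprn_gt0.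
suff ij : K * (x ^+ i * y ^+ j) < 1.
  have -> : K * (x ^+ a * x ^+ i * (y ^+ b * y ^+ j)) =
    (K * (x ^+ i * y ^+ j)) * (x ^+ a * y ^+ b) by ring.
  by rewrite -[X in _ < X]mul1r ltr_pM2r.
have xi n : x ^+ n <= 1 by rewrite exprn_ile1 // ltW.
have yj n : y ^+ n <= 1 by rewrite exprn_ile1 // ltW.
have xp n : 0 < x ^+ n by rewrite exprn_gt0.
have yp n : 0 < y ^+ n by rewrite exprn_gt0.
have : (0 < i)%N || (0 < j)%N by move: kl; rewrite /i /j; lia.
case/orP => /prednK <-; rewrite exprS.
- have := xi i.-1; have := yj j; have := xp i.-1; have := yp j.
  set u := x ^+ _; set v := y ^+ _ => v0 u0 v1 u1.
  have : u * v <= 1 by nra.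
  have : 0 < u * v by nra.
  have -> : K * (x * u * v) = x * K * (u * v) by ring.
  have : 0 < x * K by nra.
  nra.
- have := yj j.-1; have := xi i; have := yp j.-1; have := xp i.
  set u := x ^+ _; set v := y ^+ _ => u0 v0 u1 v1.
  have : u * v <= 1 by nra.
  have : 0 < u * v by nra.
  have -> : K * (u * (y * v)) = y * K * (u * v) by ring.
  have : 0 < y * K by nra.
  nra.
Qed.

(* Primitive weight orthogonal to l - k; meaningful only when k.1 < l.1 and
   l.2 < k.2, because of the truncated subtractions. *)
Definition edge_weight k l :=
  let m := (l.1 - k.1)%N in let n := (k.2 - l.2)%N in
  (n %/ gcdn m n, m %/ gcdn m n)%N.

Lemma edge_weightP k l : (k.1 < l.1)%N -> (l.2 < k.2)%N ->
  let A := edge_weight k l in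
  [/\ (0 < A.1)%N, (0 < A.2)%N, coprime A.1 A.2 &
      (A.1 * (l.1 - k.1) = A.2 * (k.2 - l.2))%N].
Proof.
move=> kl lk; rewrite /edge_weight; set m := (l.1 - k.1)%N; set n := (k.2 - l.2)%N => /=.
have m0 : (0 < m)%N by rewrite subn_gt0.
have n0 : (0 < n)%N by rewrite subn_gt0.
have g0 : (0 < gcdn m n)%N by rewrite gcdn_gt0 m0.
have [gm gn] := (dvdn_gcdl m n, dvdn_gcdr m n).
split.
- by rewrite divn_gt0 // dvdn_leq.
- by rewrite divn_gt0 // dvdn_leq.
- rewrite /coprime -(eqn_pmul2r g0) muln_gcdl !divnK // mul1n gcdnC //.
- by rewrite !divn_mulAC // mulnC.
Qed.

(** Take t^A1 = x and z = y / t^A2. Orthogonality of the weight to l - k makes the ratio of the two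
    monomials equal to z^n with n = k.2 - l.2 positive, so bounds 1/K and K on z^n carry over to
    z. *)
Lemma edge_coord k l x y K : 1 <= K -> 0 < x -> 0 < y ->
  (k.1 < l.1)%N -> (l.2 < k.2)%N ->
  mono x y k <= K * mono x y l -> mono x y l <= K * mono x y k ->
  exists t z, [/\ 0 < t, K^-1 <= z <= K, x = t ^+ (edge_weight k l).1 &
    y = t ^+ (edge_weight k l).2 * z].
Proof.
move=> K1 x0 y0 kl lk kKl lKk; have [A1 A2 _ Amn] := edge_weightP _ _ kl lk.
set A := edge_weight k l in A1 A2 Amn *.
have [t t0 tx] := pos_root _ _ A1 x0.
set m := (l.1 - k.1)%N in Amn; set n := (k.2 - l.2)%N in Amn.
have n0 : (0 < n)%N by rewrite subn_gt0.
have tA0 : 0 < t ^+ A.2 by rewrite exprn_gt0.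
have K0 : 0 < K by exact: lt_le_trans K1.
exists t, (y / t ^+ A.2); split=> //; last by rewrite mulrC divfK // gt_eqF.
have z0 : 0 < y / t ^+ A.2 by rewrite divr_gt0.
set z := y / _ in z0 *.
have xm0 : 0 < x ^+ m by rewrite exprn_gt0.
have yE : y ^+ n = x ^+ m * z ^+ n.
  by rewrite -tx -exprM Amn exprM -exprMn mulrC divfK // gt_eqF.
have c0 : 0 < x ^+ k.1 * y ^+ l.2 by rewrite mulr_gt0 // exprn_gt0.
have kE : mono x y k = x ^+ k.1 * y ^+ l.2 * x ^+ m * z ^+ n.
  by rewrite /mono -(subnKC (ltnW lk)) exprD yE; ring.
have lE : mono x y l = x ^+ k.1 * y ^+ l.2 * x ^+ m.
  by rewrite /mono -(subnKC (ltnW kl)) exprD; ring.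
have c1 : 0 < x ^+ k.1 * y ^+ l.2 * x ^+ m by rewrite mulr_gt0.
move: kKl lKk; rewrite {}kE {}lE; set c := _ * x ^+ m in c1 *.
rewrite mulrC ler_pM2r // => znK.
rewrite mulrA -[leLHS]mul1r ler_pM2r // => Kzn.
apply/andP; split.
  rewrite -[leLHS]mul1r ler_pdivrMr // leNgt; apply/negP => zK1.
  have z1 : z < 1 by nra.
  have : z ^+ n <= z.
    by rewrite -(prednK n0) exprS ger_pMr // exprn_ile1 // ltW.
  nra.
rewrite leNgt; apply/negP => Kz.
have : z <= z ^+ n.
  by rewrite -(prednK n0) exprS ler_pMr // exprn_ege1 // (le_trans K1) // ltW.
nra.
Qed.

Lemma seq_radius (T : eqType) (s : seq T) (P : T -> R -> Prop) :
  (forall a, a \in s -> exists2 r, 0 < r & forall z, 0 < z < r -> P a z) ->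
  exists2 r, 0 < r & forall a z, a \in s -> 0 < z < r -> P a z.
Proof.
elim: s => [_|a s IH hs]; first by exists 1.
have [r1 r10 h1] := hs a (mem_head _ _).
have [|r2 r20 h2] := IH; first by move=> b bs; apply: hs; rewrite inE bs orbT.
exists (Num.min r1 r2); first by rewrite lt_min r10.
move=> b z; rewrite inE lt_min => /predU1P[->|bs] /and3P[z0 z1 z2].
  by apply: h1; rewrite z0.
by apply: h2 => //; rewrite z0.
Qed.

(** In edge coordinates x = t^A1, so a bound r on t becomes r^A1 on x; y needs no bound of its own,
    being controlled by z. *)
Lemma edge_radius p k l (e d K : R) : main_nonneg p ->
  (forall A, in_Ap p A -> C2 p A \/ C2tilde p A) ->
  k \in supp p -> e != 0 -> d != 0 -> 1 <= K ->
  (k.1 < l.1)%N -> (l.2 < k.2)%N ->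
  exists2 r, 0 < r & forall x, 0 < x < r -> forall y, 0 < y ->
    mono x y k <= K * mono x y l -> mono x y l <= K * mono x y k ->
    0 <= peval p (e * x) (d * y).
Proof.
move=> H HC ks e0 d0 K1 kl lk; have [A1 A2 co _] := edge_weightP _ _ kl lk.
have K0 : 0 < K by exact: lt_le_trans K1.
have := edge_ge0 p _ k e d K H HC A1 A2 co ks e0 d0 K0.
move=> /nbhs_ballP[r /= r0 Hr].
set A := edge_weight k l in A1 A2 co Hr.
exists (r ^+ A.1); first by rewrite exprn_gt0.
move=> x /andP[x0 xr] y y0 kKl lKk.
have [t [z [t0 zK xE yE]]] := edge_coord _ _ _ _ _ K1 x0 y0 kl lk kKl lKk.
rewrite -/A in xE yE; rewrite {1}xE yE mulrC mulrCA; apply: Hr => //.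
  rewrite /ball /= sub0r normrN gtr0_norm //.
  by move: xr; rewrite xE ltr_pXn2r ?nnegrE ?ltW.
Qed.

(* Rounding (- ln x, - ln y) down costs at most l.1 + l.2 in the exponent of
   the l-th monomial, whence the factor in the domination hypothesis. *)
Lemma dominant_even_pos p k (x y : R) : main_nonneg p -> k \in supp p ->
  0 < x < expR (-1) -> 0 < y < expR (-1) ->
  (forall l, l \in supp p -> l != k ->
     expR (l.1 + l.2)%:R * mono x y l < mono x y k) ->
  even_pos p k.
Proof.
move=> H ks /andP[x0 x1] /andP[y0 y1] dom.
have log_ge1 (z : R) : 0 < z -> z < expR (-1) -> 1 <= - ln z.
  by move=> z0; rewrite -ltr_ln ?posrE ?expR_gt0 // expRK => z1; lra.
pose X := - ln x; pose Y := - ln y.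
have X1 : 1 <= X by exact: log_ge1.
have Y1 : 1 <= Y by exact: log_ge1.
have lnmono l : ln (mono x y l) = - (l.1%:R * X + l.2%:R * Y).
  rewrite /mono (lnM (exprn_gt0 _ x0) (exprn_gt0 _ y0)) (lnXn _ x0) (lnXn _ y0).
  by rewrite /X /Y !mulrN -opprD opprK !mulr_natl.
(* Since x and y lie below exp(-1), both floors are at least 1, hence admissible weights. *)
have tr (z : R) : 1 <= z -> (0 < Num.truncn z)%N /\
    (Num.truncn z)%:R <= z < (Num.truncn z)%:R + 1.
  by move=> z1; rewrite truncn_gt0 z1 natr1 truncn_itv // (le_trans _ z1).
have [tX0 /andP[tX tX1]] := tr _ X1; have [tY0 /andP[tY tY1]] := tr _ Y1.
apply: (main_form_vertex p (Num.truncn X, Num.truncn Y) k H) => // l ls lk.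
have [ml mk] := (mono_gt0 x y l x0 y0, mono_gt0 x y k x0 y0).
have eK : 0 < expR (l.1 + l.2)%:R :> R by exact: expR_gt0.
have := dom l ls lk.
rewrite -(ltr_ln (mulr_gt0 eK ml) mk) (lnM eK ml) expRK !lnmono.
rewrite /weight -(ltr_nat R) !natrD !natrM.
have := ler0n R l.1; have := ler0n R l.2; have := ler0n R k.1; have := ler0n R k.2.
move: (Num.truncn X)%:R (Num.truncn Y)%:R tX tX1 tY tY1 => a b aX aX1 bY bY1.
move: (l.1%:R) (l.2%:R) (k.1%:R) (k.2%:R) => l1 l2 k1 k2 k20 k10 l20 l10.
have : l1 * X <= l1 * (a + 1) by rewrite ler_wpM2l // ltW.
have : l2 * Y <= l2 * (b + 1) by rewrite ler_wpM2l // ltW.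
have : k1 * a <= k1 * X by rewrite ler_wpM2l.
have : k2 * b <= k2 * Y by rewrite ler_wpM2l.
lra.
Qed.

Lemma le_sum_seq (T : eqType) (s : seq T) (f : T -> R) a :
  (forall b, 0 <= f b) -> a \in s -> f a <= \sum_(b <- s) f b.
Proof. by move=> f0 /(big_rem a) ->; rewrite lerDl sumr_ge0. Qed.

(** Even exponents make the [k]-term independent of the signs [e], [d]. Every other term is at most
    |c_l| / K times [mono x y k], and by the choice of K these add up to no more than the
    [k]-term. *)
Lemma dominant_ge0 p k (e d x y K : R) : `|e| = 1 -> `|d| = 1 -> 0 < x -> 0 < y ->
  k \in supp p -> even_pos p k ->
  \sum_(l <- supp p) `|(p`_l.1)`_l.2| <= K * (p`_k.1)`_k.2 ->
  (forall l, l \in supp p -> l != k -> K * mono x y l <= mono x y k) ->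
  0 <= peval p (e * x) (d * y).
Proof.
move=> e1 d1 x0 y0 ks /and3P[c0 o1 o2] KM dom.
have sgn1 (z : R) n : `|z| = 1 :> R -> ~~ odd n -> z ^+ n = 1.
  move=> z1 on; rewrite -(odd_double_half n) (negPf on) -mul2n exprM.
  by rewrite -real_normK ?num_real // z1 !expr1n.
have M0 : 0 < \sum_(l <- supp p) `|(p`_l.1)`_l.2|.
  apply: (lt_le_trans c0); apply: le_trans (ler_norm _) _.
  exact: (le_sum_seq _ _ (fun l => `|(p`_l.1)`_l.2|)).
have K0 : 0 < K by move: (lt_le_trans M0 KM); rewrite pmulr_lgt0.
rewrite peval_sum (bigD1_seq k) ?supp_uniq //=.
have -> : term p k (e * x) (d * y) = (p`_k.1)`_k.2 * mono x y k.
  by rewrite /term !exprMn (sgn1 e) // (sgn1 d) // !mul1r mulrA.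
rewrite -lerBlDl sub0r -(ler_pM2l K0).
apply: le_trans (_ : - (\sum_(l <- supp p | l != k) `|(p`_l.1)`_l.2| * mono x y k) <= _).
  rewrite mulrN lerN2 mulrA; rewrite -mulr_suml ler_pM2r ?mono_gt0 //.
  apply: le_trans KM; rewrite [leRHS](bigD1_seq k) ?supp_uniq //=.
  by rewrite lerDr.
rewrite -sumrN mulr_sumr big_seq_cond [leRHS]big_seq_cond; apply: ler_sum => l /andP[ls lk].
have : `|K * term p l (e * x) (d * y)| <= `|(p`_l.1)`_l.2| * mono x y k.
  rewrite /term !exprMn !normrM !normrX e1 d1 !expr1n !mul1r.
  rewrite (gtr0_norm K0) (gtr0_norm x0) (gtr0_norm y0) -[X in K * X]mulrA mulrCA ler_wpM2l //; exact: dom.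
by rewrite ler_norml => /andP[].
Qed.

(** * Open quadrants, axes and conclusion *)

Lemma quadrant_ge0 p (e d : R) : main_nonneg p ->
  (forall A, in_Ap p A -> C2 p A \/ C2tilde p A) ->
  `|e| = 1 -> `|d| = 1 ->
  exists2 r, 0 < r & forall x y, 0 < x < r -> 0 < y < r -> 0 <= peval p (e * x) (d * y).
Proof.
move=> H HC e1 d1.
have unit_neq0 (z : R) : `|z| = 1 :> R -> z != 0 by rewrite -normr_eq0 => ->; rewrite oner_eq0.
pose M := \sum_(l <- supp p) `|(p`_l.1)`_l.2|.
(* The first summand is the factor asked for by [dominant_even_pos], the second the one asked for by
   [dominant_ge0]; K exceeds all of them. *)
pose w (l : nat * nat) : R := expR (l.1 + l.2)%:R + M / `|(p`_l.1)`_l.2|.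
have M0 : 0 <= M by rewrite sumr_ge0.
have w0 l : 0 <= w l by rewrite addr_ge0 ?expR_ge0 // divr_ge0.
pose K := 1 + \sum_(l <- supp p) w l.
have wK l : l \in supp p -> w l <= K.
  by move=> ls; rewrite /K ler_wpDl ?ler01 //; exact: le_sum_seq.
have K1 : 1 <= K by rewrite lerDl sumr_ge0.
have K0 : 0 < K by exact: lt_le_trans K1.
pose P (kl : (nat * nat) * (nat * nat)) x := (kl.1.1 < kl.2.1)%N -> (kl.2.2 < kl.1.2)%N ->
  forall y, 0 < y -> mono x y kl.1 <= K * mono x y kl.2 ->
    mono x y kl.2 <= K * mono x y kl.1 -> 0 <= peval p (e * x) (d * y).
have [|r r0 Pr] := @seq_radius _ [seq (k, l) | k <- supp p, l <- supp p] P.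
  move=> _ /allpairsP[[k l] /= [ks ls ->]]; rewrite /P /=.
  have [kl|] := ltnP k.1 l.1; last by exists 1.
  have [lk|] := ltnP l.2 k.2; last by exists 1.
  have [r r0 hr] := edge_radius p k l e d K H HC ks (unit_neq0 _ e1) (unit_neq0 _ d1) K1 kl lk.
  by exists r => // z zr _ _; exact: hr.
(* The three bounds serve the finitely many edges, [mono_ratio] and the floors in
   [dominant_even_pos]. *)
exists (Num.min r (Num.min K^-1 (expR (-1)))).
  by rewrite !lt_min r0 invr_gt0 K0 expR_gt0.
move=> x y /andP[x0]; rewrite !lt_min => /and3P[xr xK x1] /andP[y0 /and3P[yr yK y1]].
have xK1 : x * K < 1 by rewrite -ltr_pdivlMr // mul1r.
have yK1 : y * K < 1 by rewrite -ltr_pdivlMr // mul1r.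
have edge k l : k \in supp p -> l \in supp p -> k != l ->
    mono x y k <= K * mono x y l -> mono x y l <= K * mono x y k ->
    0 <= peval p (e * x) (d * y).
  wlog kl1 : k l / (k.1 <= l.1)%N.
    move=> W ks ls kl kKl lKk; have [kl1|/ltnW lk1] := leqP k.1 l.1; first exact: (W k l).
    by apply: (W l k) => //; rewrite eq_sym.
  move=> ks ls kl kKl lKk.
  have lk2 := mono_ratio _ _ _ _ _ K1 x0 y0 xK1 yK1 kl kl1 kKl.
  apply: (Pr (k, l) x _ _ _ lk2) => //=; rewrite ?x0 //; first by apply/allpairsP; exists (k, l).
  (* If the first exponents agreed, [mono_ratio] with k and l exchanged would reverse the strict
     inequality [lk2]. *)
  rewrite ltn_neqAle kl1 andbT; apply/eqP => e12.
  have := mono_ratio _ _ _ _ _ K1 x0 y0 xK1 yK1 (_ : l != k) _ lKk.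
  by rewrite eq_sym kl e12 leqnn => /(_ isT isT); rewrite ltnNge ltnW.
case Es: (supp p) => [|k1 s]; first by rewrite peval_sum Es big_nil.
have [k ks kmax] : exists2 k, k \in supp p & forall l, l \in supp p -> mono x y l <= mono x y k.
  by apply: (@seq_argmax _ _ _ (mono x y) _ k1); rewrite Es mem_head.
case: (boolP (has (fun l => (l != k) && (mono x y k <= K * mono x y l)) (supp p))).
  move=> /hasP[l ls /andP[lk kKl]]; apply: (edge k l) => //; first by rewrite eq_sym.
  by apply: le_trans (kmax l ls) _; rewrite ler_peMl // ltW // mono_gt0.
move=> /hasPn dom.
have {}dom l : l \in supp p -> l != k -> K * mono x y l < mono x y k.
  by move=> /dom; rewrite negb_and negbK -ltNge => /orP[/eqP ->|//]; rewrite eqxx.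
have ek : even_pos p k.
  apply: (dominant_even_pos p k x y H ks); rewrite ?x0 ?y0 // => l ls lk.
  apply: le_lt_trans (dom l ls lk); rewrite ler_pM2r ?mono_gt0 //.
  by apply: le_trans (wK l ls); rewrite lerDl divr_ge0.
apply: (dominant_ge0 p k e d x y K) => //; last by move=> l ls lk; rewrite ltW // dom.
have /and3P[c0 _ _] := ek.
rewrite -ler_pdivrMr //; apply: le_trans (wK k ks).
by rewrite /w gtr0_norm // lerDr expR_ge0.
Qed.

(** Two limits: y to 0 for fixed nonzero x, then x to 0 for fixed y. *)
Lemma off_axes_ge0 p r : 0 < r ->
  (forall x y, x != 0 -> y != 0 -> `|x| < r -> `|y| < r -> 0 <= peval p x y) ->
  forall x y, `|x| < r -> `|y| < r -> 0 <= peval p x y.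
Proof.
move=> r0 Hp x y xr yr.
have Hx u v : u != 0 -> `|u| < r -> `|v| < r -> 0 <= peval p u v.
  move=> u0 ur vr; have [->|v0] := eqVneq v 0; last exact: Hp.
  rewrite peval_yslice; apply: (horner_ge0_at0 _ r) => // z z0 zr.
  by rewrite -peval_yslice; exact: Hp.
have [->|x0] := eqVneq x 0; last exact: Hx.
rewrite /peval; apply: (horner_ge0_at0 _ r) => // z z0 zr.
exact: Hx.
Qed.
End LocalMinimum.

Theorem theorem4 (R : realType) (p : {poly {poly R}}) :
  peval p 0 0 = 0 ->
  peval (dx p) 0 0 = 0 -> peval (dy p) 0 0 = 0 ->
  conv_dim2 p ->
  (forall A : nat * nat, (0 < A.1)%N -> (0 < A.2)%N ->
     forall x y : R, 0 <= peval (main_form p A) x y) ->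
  (exists A, in_Ap p A) ->
  (forall A, in_Ap p A -> C2 p A \/ C2tilde p A) ->
  local_min_at0 p.
Proof.
move=> p00 _ _ _ H _ HC; rewrite /local_min_at0 p00.
(* [s] selects a quadrant by its signs, and [z] will be the larger of |x| and |y|, so that one
   radius serves all four quadrants. *)
pose Q (s : R * R) z := forall x y, 0 < x <= z -> 0 < y <= z -> 0 <= peval p (s.1 * x) (s.2 * y).
have [|r r0 hr] := @seq_radius R _ [seq (a, b) | a <- [:: 1; -1], b <- [:: 1; -1]] Q.
  move=> _ /allpairsP[[a b] /= [ha hb ->]].
  have norm1 (c : R) : c \in [:: 1; -1] -> `|c| = 1.
    by rewrite !inE => /orP[] /eqP ->; rewrite ?normrN normr1.
  have [r r0 hr] := quadrant_ge0 R p a b H HC (norm1 _ ha) (norm1 _ hb).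
  exists r => // z /andP[_ zr] x y /andP[x0 xz] /andP[y0 yz].
  by apply: hr; rewrite ?x0 ?y0; [exact: le_lt_trans xz zr | exact: le_lt_trans yz zr].
exists r => //; apply: off_axes_ge0 => // x y x0 y0 xr yr.
have sg1 (c : R) : c != 0 -> Num.sg c \in [:: 1; -1].
  by rewrite !inE; case: sgrP => //; rewrite ?eqxx ?orbT.
rewrite (numEsg x) (numEsg y).
apply: (hr (Num.sg x, Num.sg y) (Num.max `|x| `|y|)).
- by apply/allpairsP; exists (Num.sg x, Num.sg y); rewrite !sg1.
- by rewrite lt_max normr_gt0 x0 gt_max xr.
- by rewrite normr_gt0 x0 le_max lexx.
- by rewrite normr_gt0 y0 le_max lexx orbT.
Qed.
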